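(* For every nonnegative integer $n$, $$\sum_{j=0}^{\infty}pod(j)\,pod(n-j)=\sum_{j=-\infty}^{\infty}p_3\!\left(\frac n2-\frac{j^2}{2}\right),$$ where $p_3(x)=0$ if $x$ is not an integer.
   Context: $pod(n)$ denotes the number of partitions of $n$ in which odd parts are distinct and even parts may be repeated, with $pod(0)=1$. $p_3(n)$ denotes the number of partitions of $n$ in three colors, with generating function $\sum_{n\ge0}p_3(n)q^n=\prod_{k\ge1}\frac{1}{(1-q^k)^3}$. Both $pod$ and $p_3$ are $0$ at negative arguments. *)

(* Defs.v *)
From HB Require Import structures.
From mathcomp Require Import all_boot all_order all_algebra.
From mathcomp Require Import archimedean.

Set Implicit Arguments.
Unset Strict Implicit.
Unset Printing Implicit Defensive.

Import GRing.Theory Num.Theory.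

(* A partition is encoded by its multiplicities: [m i] is the number of times
   the part [i.+1] occurs. In a partition of [n] every part and every
   multiplicity is at most [n], so the finite types below lose nothing. *)
Definition pod_set (n : nat) : {set {ffun 'I_n -> 'I_n.+1}} :=
  [set m : {ffun 'I_n -> 'I_n.+1} |
    (\sum_(i < n) m i * i.+1 == n) && [forall i : 'I_n, odd i.+1 ==> (m i <= 1)]].

Definition pod (z : int) : nat :=
  if z is Posz n then #|pod_set n| else 0.

(* [m (i, c)] is the number of times the part [i.+1] occurs in color [c]. *)
Definition p3_set (n : nat) : {set {ffun 'I_n * 'I_3 -> 'I_n.+1}} :=
  [set m : {ffun 'I_n * 'I_3 -> 'I_n.+1} |
    \sum_(i < n) \sum_(c < 3) m (i, c) * i.+1 == n].

Definition p3_int (z : int) : nat :=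
  if z is Posz n then #|p3_set n| else 0.

Definition p3 (x : rat) : nat :=
  if x \is a Num.int then p3_int (numq x) else 0.

(* Main.v *)
(* Let [A] and [B] be the generating functions of [pod] and [p3], and put
   [E = \prod_k (1 - q^(2k))], [O = \prod_k (1 + q^(2k-1))]. Then [A E = O],
   [B(q^2) E^3 = 1], and Jacobi's triple product at [z = 1] reads
   [\sum_j q^(j^2) = O^2 E]. Hence [A^2 E^3 = O^2 E = (\sum_j q^(j^2)) B(q^2) E^3],
   and [E^3] cancels. Everything is done with truncated products, in integer
   polynomials modulo [q^(n+1)]; the triple product comes from Gauss's
   binomial theorem, whose coefficients [gauss_bin (q^2) 2m i] with [i] near
   [m] agree with [1/E] modulo [q^(n+1)] when [m] is large. *)
Require Import Defs.
From HB Require Import structures.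
From mathcomp Require Import all_boot all_order all_algebra.
From mathcomp Require Import archimedean.
From mathcomp Require Import boolp classical_sets cardinality fsbigop.
From mathcomp Require Import zify ring.

Set Implicit Arguments.
Unset Strict Implicit.
Unset Printing Implicit Defensive.

Import GRing.Theory Num.Theory.
Local Open Scope ring_scope.

(** * Congruence of polynomials modulo [X^(n+1)] *)

Definition eqmodX (R : nzRingType) (n : nat) (p q : {poly R}) : Prop :=
  forall i, (i <= n)%N -> p`_i = q`_i.

Lemma eqmodX_refl (R : nzRingType) n (p : {poly R}) : eqmodX n p p.
Proof. by []. Qed.

Lemma eqmodX_sym (R : nzRingType) n (p q : {poly R}) :
  eqmodX n p q -> eqmodX n q p.
Proof. by move=> pq i le_in; rewrite pq. Qed.

Lemma eqmodX_trans (R : nzRingType) n (p q r : {poly R}) :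
  eqmodX n p q -> eqmodX n q r -> eqmodX n p r.
Proof. by move=> pq qr i le_in; rewrite pq ?qr. Qed.

Lemma eqmodX_leq (R : nzRingType) m n (p q : {poly R}) :
  (m <= n)%N -> eqmodX n p q -> eqmodX m p q.
Proof. by move=> le_mn pq i le_im; apply: pq; apply: leq_trans le_mn. Qed.

Lemma eqmodX_mul (R : nzRingType) n (p q r s : {poly R}) :
  eqmodX n p q -> eqmodX n r s -> eqmodX n (p * r) (q * s).
Proof.
move=> pq rs i le_in; rewrite !coefM; apply: eq_bigr => k _.
by rewrite pq ?rs //; have := ltn_ord k; lia.
Qed.

Lemma eqmodX_sum (R : nzRingType) n I (r : seq I) (F G : I -> {poly R}) :
  (forall i, eqmodX n (F i) (G i)) ->
  eqmodX n (\sum_(i <- r) F i) (\sum_(i <- r) G i).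
Proof.
move=> FG i le_in; rewrite !coef_sum; apply: eq_bigr => k _.
exact: FG.
Qed.

Lemma eqmodX_prod (R : nzRingType) n I (r : seq I) (F G : I -> {poly R}) :
  (forall i, eqmodX n (F i) (G i)) ->
  eqmodX n (\prod_(i <- r) F i) (\prod_(i <- r) G i).
Proof.
by move=> FG; apply: (big_ind2 (eqmodX n)) => // *; apply: eqmodX_mul.
Qed.

Lemma eqmodX_prod1 (R : nzRingType) n I (r : seq I) (F : I -> {poly R}) :
  (forall i, eqmodX n (F i) 1) -> eqmodX n (\prod_(i <- r) F i) 1.
Proof.
move=> F1; apply: (big_ind (fun p => eqmodX n p 1)) => // p q p1 q1.
by rewrite -[1]mulr1; apply: eqmodX_mul.
Qed.

Lemma eqmodX_cancel (R : nzRingType) n (c p q : {poly R}) :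
  c`_0 = 1 -> eqmodX n (c * p) (c * q) -> eqmodX n p q.
Proof.
move=> c0 cpq; elim/ltn_ind => i IHi le_in.
have := cpq i le_in; rewrite !coefM !big_ord_recl /= subn0 c0 !mul1r.
rewrite (eq_bigr (fun k : 'I_i => c`_(lift ord0 k) * q`_(i - lift ord0 k))).
  by apply: addIr.
by move=> k _; rewrite IHi // /lift /= /bump /=; have := ltn_ord k; lia.
Qed.

Lemma eqmodX_XnM (R : nzRingType) n k (p q : {poly R}) :
  (n < k)%N -> eqmodX n ('X^k * p) ('X^k * q).
Proof. by move=> lt_nk i le_in; rewrite !coefXnM; case: ltnP => //; lia. Qed.

(** The factors of index at least [n] are all 1 modulo [X^(n+1)]. *)
Lemma eqmodX_prod_widen (R : nzRingType) n m (F : nat -> {poly R}) :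
  (n <= m)%N -> (forall i, eqmodX i (F i) 1) ->
  eqmodX n (\prod_(i < m) F i) (\prod_(i < n) F i).
Proof.
move=> le_nm F1; elim: m le_nm => [|m IHm].
  by rewrite leqn0 => /eqP->; apply: eqmodX_refl.
rewrite leq_eqVlt => /predU1P[->|lt_nm]; first exact: eqmodX_refl.
rewrite big_ord_recr /= -[X in eqmodX n _ X]mulr1.
by apply: eqmodX_mul; [apply: IHm|apply: eqmodX_leq (F1 m)].
Qed.

Lemma coef0_prod1 (R : comNzRingType) I (r : seq I) (F : I -> {poly R}) :
  (forall i, (F i)`_0 = 1) -> (\prod_(i <- r) F i)`_0 = 1.
Proof.
move=> F1; rewrite -horner_coef0 horner_prod big1 // => i _.
by rewrite horner_coef0.
Qed.

Lemma eqmodX_1BXn (R : nzRingType) n k :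
  (n < k)%N -> eqmodX n (1 - 'X^k : {poly R}) 1.
Proof.
move=> lt_nk i le_in; rewrite coefB coefXn.
by rewrite (_ : (i == k) = false) ?subr0 //; lia.
Qed.

Lemma eqmodX_1DXn (R : nzRingType) n k :
  (n < k)%N -> eqmodX n (1 + 'X^k : {poly R}) 1.
Proof.
move=> lt_nk i le_in; rewrite coefD coefXn.
by rewrite (_ : (i == k) = false) ?addr0 //; lia.
Qed.

Lemma eqmodX_geometric (R : comNzRingType) n k :
  (0 < k)%N ->
  eqmodX n ((\sum_(j < n.+1) 'X^(j * k)) * (1 - 'X^k) : {poly R}) 1.
Proof.
move=> k_gt0; have -> : (\sum_(j < n.+1) 'X^(j * k)) * (1 - 'X^k)
    = 1 - 'X^(k * n.+1) :> {poly R}.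
  rewrite -opprB mulrN mulrC -[RHS]opprB exprM [in RHS]subrX1; congr (- (_ * _)).
  by apply: eq_bigr => j _; rewrite -exprM mulnC.
by apply: eqmodX_1BXn; rewrite mulnS; nia.
Qed.

(** Expanding the product chooses one [k] for each [i], hence a function [m], whose monomial has the
    weighted sum as its degree. *)
Lemma card_weighted (R : comNzRingType) (I : finType) n (w : I -> nat)
    (C : I -> pred 'I_n.+1) d :
  #|[set m : {ffun I -> 'I_n.+1} |
      (\sum_i m i * w i == d)%N && [forall i, C i (m i)]]|%:R =
  (\prod_i \sum_(k < n.+1 | C i k) 'X^(k * w i) : {poly R})`_d.
Proof.
rewrite bigA_distr_big_dep coef_sum -sum1_card natr_sum.
rewrite big_mkcond [RHS]big_mkcond /=; apply: eq_bigr => m _.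
rewrite inE prodrXr coefXn eq_sym andbC unfold_in /=.
by case: [forall i, _]; case: eqP.
Qed.

(** * Gaussian binomial coefficients and the finite triple product *)

Fixpoint gauss_bin (R : nzRingType) (x : R) (n k : nat) : R :=
  match n, k with
  | _, 0%N => 1
  | 0%N, _.+1 => 0
  | n'.+1, k'.+1 => gauss_bin x n' k' + x ^+ k * gauss_bin x n' k
  end.

Lemma gauss_bin0 (R : nzRingType) (x : R) n : gauss_bin x n 0 = 1.
Proof. by case: n. Qed.

Lemma gauss_bin_small (R : nzRingType) (x : R) n k :
  (n < k)%N -> gauss_bin x n k = 0.
Proof.
elim: n k => [|n IHn] [|k] //= lt_nk.
by rewrite !IHn ?mulr0 ?addr0 //; lia.
Qed.

(** Induction with [b] general: once the factor [k = 0] is split off, the others have the same form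
    with [b * x] for [b], and the recurrence of [gauss_bin] recombines the two sums. *)
Lemma gauss_binomial (R : comNzRingType) (x a b : R) n :
  \prod_(k < n) (a + b * x ^+ k) =
  \sum_(j < n.+1) gauss_bin x n j * x ^+ 'C(j, 2) * b ^+ j * a ^+ (n - j).
Proof.
elim: n b => [|n IHn] b.
  by rewrite big_ord0 big_ord1 /= !mulr1.
rewrite big_ord_recl /= mulr1.
under eq_bigr => k _ do rewrite /bump /= add1n exprS mulrA.
rewrite IHn mulrDl.
rewrite [RHS]big_ord_recl /= !mulr1 mul1r subn0.
under [X in _ = _ + X]eq_bigr => j _.
  rewrite /bump /= add1n subSS !mulrDl; over.
rewrite big_split /= addrCA [LHS]addrC; congr (_ + _).
  rewrite mulr_sumr; apply: eq_bigr => j _.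
  by rewrite binS bin1 exprD exprMn !exprS; ring.
rewrite big_ord_recl big_ord_recr /= gauss_bin0 gauss_bin_small //.
rewrite bin0n expr0 subn0 !mulr1 mul1r exprS !(mulr0, mul0r) addr0.
rewrite mulrDr mulr_sumr; congr (_ + _); apply: eq_bigr => j _.
rewrite /bump /= add1n.
have -> : (n - j = (n - j.+1).+1)%N by have := ltn_ord j; lia.
by rewrite exprMn [b ^+ j.+1]exprS [a ^+ _.+1]exprS; ring.
Qed.

(** The q-Pochhammer symbol [(x; x)_n]. *)
Definition qpoch (R : nzRingType) (x : R) n : R :=
  \prod_(k < n) (1 - x ^+ k.+1).

Lemma qpochS (R : nzRingType) (x : R) n :
  qpoch x n.+1 = qpoch x n * (1 - x ^+ n.+1).
Proof. by rewrite /qpoch big_ord_recr. Qed.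

(** The quotient formula, free of division. The induction rests on [1 - x^(n+1) = (1 - x^(k+1)) +
    x^(k+1) (1 - x^(n-k))]. *)
Lemma gauss_bin_qpoch (R : comNzRingType) (x : R) n k : (k <= n)%N ->
  gauss_bin x n k * qpoch x k * qpoch x (n - k) = qpoch x n.
Proof.
elim: n k => [|n IHn] [|k] // le_kn.
- by rewrite subn0 /qpoch !big_ord0 !mulr1.
- by rewrite subn0 gauss_bin0 {1}/qpoch big_ord0 !mul1r.
rewrite subSS /= [in RHS]qpochS; have IHk := IHn k le_kn.
move: le_kn; rewrite ltnS leq_eqVlt => /predU1P[eq_kn|lt_kn].
  rewrite [gauss_bin x n k.+1]gauss_bin_small ?eq_kn // mulr0 addr0 qpochS.
  by rewrite -[in RHS]IHk eq_kn; ring.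
have IHk1 := IHn k.+1 lt_kn; have dec : (n - k = (n - k.+1).+1)%N by lia.
have -> : x ^+ n.+1 = x ^+ k.+1 * x ^+ (n - k).
  by rewrite -exprD; congr (_ ^+ _); lia.
transitivity (qpoch x n * (1 - x ^+ k.+1)
              + x ^+ k.+1 * (qpoch x n * (1 - x ^+ (n - k)))); last by ring.
by rewrite -{1}IHk -IHk1 dec !qpochS; ring.
Qed.

Lemma mul2_bin2 n : (2 * 'C(n, 2) = n * n.-1)%N.
Proof. by elim: n => [|[|n] IHn] //; rewrite binS bin1 mulnDr IHn /=; lia. Qed.

(* Gauss's binomial theorem with [x = q^2], [a = q^(2m-1)] and [b = 1],
   divided by a power of [q]. *)
Lemma finite_triple_product (R : idomainType) (q : R) m : q != 0 ->
  \sum_(i < m.*2.+1)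
    gauss_bin (q ^+ 2) m.*2 i * q ^+ (`|i%:Z - m%:Z|%N ^ 2) =
  (\prod_(k < m) (1 + q ^+ k.*2.+1)) ^+ 2.
Proof.
case: m => [|m] q_neq0; first by rewrite big_ord1 big_ord0 !expr0 mulr1 expr1n.
set M := m.+1.
have := gauss_binomial (q ^+ 2) (q ^+ m.*2.+1) 1 M.*2.
have qM_neq0 : q ^+ (M * m + m.*2.+1 * M) != 0 by rewrite expf_neq0.
move=> binom; apply: (mulfI qM_neq0).
transitivity (\prod_(k < M.*2) (q ^+ m.*2.+1 + 1 * q ^+ 2 ^+ k)).
  rewrite binom mulr_sumr; apply: eq_bigr => i _.
  rewrite expr1n mulr1 -!exprM mulrCA -mulrA -!exprD; congr (_ * q ^+ _).
  have := mul2_bin2 i; have := ltn_ord i; rewrite ltnS; move: (nat_of_ord i).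
  move=> {}i le_iM bini; set d := `|_|%N; set t := 'C(i, 2) in bini *.
  (* The exponents match because [(i - M)^2 + M(M-1) + (2M-1)M = i(i-1) + (2M-1)(2M-i)]; the sign of
     [i - M] is fixed first, since the square is that of an absolute value. *)
  have /orP[/eqP di|/eqP di] : (i == M + d)%N || (i + d == M)%N.
  + by rewrite /d /M; lia.
  + clearbody d t; rewrite di /M /= in le_iM bini *; nia.
  + clearbody d t; case: i => [|j] in le_iM bini di *; first by nia.
    have mE : m = (j + d)%N by rewrite /M in di; lia.
    rewrite /M mE /= in bini *.
    have -> : ((j + d).+1.*2 - j.+1 = j + d + d + 1)%N by lia.
    by nia.
(* For [i < M], factor [i] is [q^(2i) (1 + q^(2(M-i)-1))] and factor [M + i] is
   [q^(2M-1) (1 + q^(2i+1))]. Each half runs through the odd exponents below [2M], the first one in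
   reverse order. *)
rewrite -addnn big_split_ord /=.
have -> : \prod_(i < M) (q ^+ m.*2.+1 + 1 * q ^+ 2 ^+ i)
   = q ^+ (M * m) * \prod_(k < M) (1 + q ^+ k.*2.+1).
  have -> : q ^+ (M * m) = \prod_(i < M) q ^+ (2 * i).
    rewrite prodrXr -big_distrr /=; congr (_ ^+ _).
    by rewrite -[m]/M.-1 -mul2_bin2 -bin2_sum big_mkord.
  rewrite [X in _ = _ * X](reindex_inj rev_ord_inj) /= -big_split /=.
  apply: eq_bigr => i _; rewrite mul1r subSS -exprM mulrDr mulr1 -exprD [LHS]addrC.
  have /[!ltnS] le_im := ltn_ord i.
  by congr (_ + q ^+ _); lia.
have -> : \prod_(i < M) (q ^+ m.*2.+1 + 1 * q ^+ 2 ^+ (M + i))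
   = q ^+ (m.*2.+1 * M) * \prod_(k < M) (1 + q ^+ k.*2.+1).
  rewrite exprM -[in X in X * _](card_ord M) -prodr_const -big_split /=.
  apply: eq_bigr => i _; rewrite mul1r -exprM mulrDr mulr1 -exprD.
  by congr (_ + q ^+ _); lia.
by rewrite exprD; ring.
Qed.

(** * Truncated generating functions of [pod] and [p3] *)

Lemma eqmodX_comp_Xn (R : nzRingType) n k (p q : {poly R}) :
  (0 < k)%N -> eqmodX n p q -> eqmodX n (p \Po 'X^k) (q \Po 'X^k).
Proof.
move=> k_gt0 pq i le_in; rewrite !coef_comp_poly_Xn //; case: ifP => // _.
by apply: pq; apply: leq_trans le_in; apply: leq_div.
Qed.

(* [A n] is the quotient of the partial products up to [n], and a quotient of
   power series with constant term 1 is determined modulo [X^(m+1)] by its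
   first [m] factors. *)
Lemma eqmodX_quotient_stable (R : comNzRingType) (A D N : nat -> {poly R}) :
  (forall n, eqmodX n (A n * \prod_(i < n) D i) (\prod_(i < n) N i)) ->
  (forall i, eqmodX i (D i) 1) -> (forall i, eqmodX i (N i) 1) ->
  forall m n, (m <= n)%N -> eqmodX m (A n) (A m).
Proof.
move=> ADN D1 N1 m n le_mn.
have prodD1 : (\prod_(i < m) D i)`_0 = 1.
  by apply: coef0_prod1 => i; rewrite D1 // coef1.
apply: (eqmodX_cancel prodD1); rewrite ![_ * A _]mulrC.
apply: (@eqmodX_trans _ _ _ (A n * \prod_(i < n) D i)).
  by apply: eqmodX_mul; [apply: eqmodX_refl|apply/eqmodX_sym/eqmodX_prod_widen].
apply: eqmodX_trans (eqmodX_leq le_mn (ADN n)) _.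
apply: eqmodX_trans (eqmodX_sym (ADN m)).
exact: eqmodX_prod_widen.
Qed.

(* Only the coefficients of degree at most [n] are those of the full product. *)
Definition pod_gf n : {poly int} :=
  \prod_(i < n) \sum_(k < n.+1 | odd i.+1 ==> (k <= 1)%N) 'X^(k * i.+1).

Definition pod_den i : {poly int} := if odd i.+1 then 1 else 1 - 'X^(i.+1).

Definition pod_num i : {poly int} := if odd i.+1 then 1 + 'X^(i.+1) else 1.

Lemma pod_gf_quotient n :
  eqmodX n (pod_gf n * \prod_(i < n) pod_den i) (\prod_(i < n) pod_num i).
Proof.
rewrite -big_split /=; apply: eqmodX_prod => i.
rewrite /pod_den /pod_num /=; case: (odd i) => /=.
  exact: eqmodX_geometric.
(* An odd part has multiplicity 0 or 1; both values lie in the range of [k], since [n] is positive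
   once an index [i] exists. *)
rewrite mulr1; case: n i => [|n] i; first by case: i.
rewrite big_mkcond !big_ord_recl /= big1 ?addr0 ?mul1n; last first.
  by move=> k _; rewrite /bump.
by rewrite mul0n expr0; apply: eqmodX_refl.
Qed.

Lemma pod_gf_stable m n : (m <= n)%N -> eqmodX m (pod_gf n) (pod_gf m).
Proof.
apply: (eqmodX_quotient_stable pod_gf_quotient) => i; rewrite /pod_den /pod_num.
  by case: ifP => _; [apply: eqmodX_refl|apply: eqmodX_1BXn].
by case: ifP => _; [apply: eqmodX_1DXn|apply: eqmodX_refl].
Qed.

(** Stability replaces [n] by [j], the bound that the encoding of [pod j] puts on parts and
    multiplicities. *)
Lemma coef_pod_gf (j n : nat) : (j <= n)%N -> (pod_gf n)`_j = (pod j)%:R.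
Proof.
move=> le_jn; rewrite (pod_gf_stable le_jn) //; apply/esym.
exact: (@card_weighted int 'I_j j (fun i => i.+1)
  (fun i k => odd i.+1 ==> (k <= 1)%N)).
Qed.

Definition p3_gf n : {poly int} :=
  \prod_(i < n) \prod_(c < 3) \sum_(k < n.+1) 'X^(k * i.+1).

Lemma p3_gf_quotient n :
  eqmodX n (p3_gf n * \prod_(i < n) (1 - 'X^(i.+1)) ^+ 3) 1.
Proof.
rewrite -big_split; apply: eqmodX_prod1 => i /=.
have -> : (1 - 'X^(i.+1) : {poly int}) ^+ 3 = \prod_(c < 3) (1 - 'X^(i.+1)).
  by rewrite prodr_const card_ord.
by rewrite -big_split; apply: eqmodX_prod1 => c; apply: eqmodX_geometric.
Qed.

Lemma p3_gf_stable m n : (m <= n)%N -> eqmodX m (p3_gf n) (p3_gf m).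
Proof.
apply: (@eqmodX_quotient_stable _ _ (fun i => (1 - 'X^(i.+1)) ^+ 3) (fun=> 1)).
- by move=> k; rewrite [X in eqmodX _ _ X]big1 //; apply: p3_gf_quotient.
- move=> i; rewrite -[3%N]card_ord -prodr_const.
  by apply: eqmodX_prod1 => _; apply: eqmodX_1BXn.
- by move=> i; apply: eqmodX_refl.
Qed.

Lemma coef_p3_gf (j n : nat) : (j <= n)%N -> (p3_gf n)`_j = (p3_int j)%:R.
Proof.
move=> le_jn; rewrite (p3_gf_stable le_jn) // /p3_gf pair_big /=.
have := @card_weighted int ('I_j * 'I_3)%type j (fun i => i.1.+1) (fun=> predT) j.
move=> /= <-; congr (_%:R); apply: eq_card => m; rewrite !inE.
rewrite pair_big /= andbC (_ : [forall _, _] = true) /=; last exact/forallP.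
by congr (_ == _); apply: eq_bigr => -[].
Qed.

(** * Values of [p3] at half-differences *)

Lemma p3_half (n d : nat) :
  p3 (n%:Q / 2 - d%:Q / 2) =
  if (d <= n)%N && (2 %| n - d)%N then p3_int ((n - d) %/ 2)%N else 0%N.
Proof.
rewrite /p3; case: ifP => [/intrP[z zE]|notint].
  rewrite zE numq_int.
  have {}zE : n%:Z = d%:Z + 2 * z.
    by apply: (@intr_inj rat); rewrite rmorphD rmorphM /= -zE; field.
  case: z zE => z zE.
    have -> : n = (d + z * 2)%N by lia.
    by rewrite leq_addr addKn dvdn_mull // mulnK.
  by case: ifP => //; lia.
case: ifP => // /andP[le_dn /dvdnP[k kE]]; case/negP: notint; apply/intrP.
exists k%:Z; have -> : n = (d + k * 2)%N by lia.
by rewrite PoszD PoszM rmorphD rmorphM /=; field.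
Qed.

Lemma p3_half_sqr (n : nat) (j : int) :
  p3 (n%:Q / 2 - j%:Q ^+ 2 / 2) =
  if (absz j ^ 2 <= n)%N && (2 %| n - absz j ^ 2)%N
  then p3_int ((n - absz j ^ 2) %/ 2)%N else 0%N.
Proof. by rewrite -p3_half -abszX gez0_abs ?sqr_ge0 // rmorphXn. Qed.

(** * The triple product modulo [X^(n+1)] *)

Lemma qpoch_X2_stable n m : (n <= m)%N ->
  eqmodX n (qpoch 'X^2 m) (qpoch 'X^2 n : {poly int}).
Proof.
move=> le_nm; apply: (@eqmodX_prod_widen _ _ _ (fun k => 1 - 'X^2 ^+ k.+1)) => //.
by move=> i; rewrite -exprM; apply: eqmodX_1BXn; lia.
Qed.

Lemma coef0_qpoch_X2 n : (qpoch 'X^2 n : {poly int})`_0 = 1.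
Proof.
by apply: coef0_prod1 => i; rewrite -exprM coefB coef1 coefXn mulnS.
Qed.

(** By the quotient formula the coefficient is a ratio of products of lengths [2m], [i] and
    [2m - i]. All three lengths are at least [n], so each product agrees with [qpoch 'X^2 m]. *)
Lemma eqmodX_gauss_bin n m i : (n <= m)%N -> (n <= i)%N -> (n + i <= m.*2)%N ->
  eqmodX n (gauss_bin 'X^2 m.*2 i * qpoch 'X^2 m : {poly int}) 1.
Proof.
move=> le_nm le_ni le_nmi; apply: (eqmodX_cancel (coef0_qpoch_X2 m)).
rewrite mulrC mulr1.
apply: (@eqmodX_trans _ _ _ (qpoch 'X^2 m.*2)); last first.
  apply: eqmodX_trans (qpoch_X2_stable _) (eqmodX_sym (qpoch_X2_stable _)) => //.
  lia.
rewrite -(@gauss_bin_qpoch _ _ m.*2 i); last lia.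
have mN k : (n <= k)%N -> eqmodX n (qpoch 'X^2 m : {poly int}) (qpoch 'X^2 k).
  move=> le_nk; apply: eqmodX_trans (eqmodX_sym (qpoch_X2_stable le_nk)).
  exact: qpoch_X2_stable.
apply: eqmodX_mul; last by apply: mN; lia.
by apply: eqmodX_mul; [apply: eqmodX_refl|apply: mN].
Qed.

(** A term with [(i - m)^2 > n] vanishes in degrees up to [n]. Otherwise [|i - m| <= n], and
    [2n <= m] keeps both [i] and [2m - i] at least [n]. *)
Lemma eqmodX_triple_product n m : (n.*2 <= m)%N ->
  eqmodX n ((\prod_(k < m) (1 + 'X^(k.*2.+1))) ^+ 2 * qpoch 'X^2 m : {poly int})
    (\sum_(i < m.*2.+1) 'X^(`|i%:Z - m%:Z|%N ^ 2)).
Proof.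
move=> le_nm; rewrite -finite_triple_product ?polyX_eq0 // mulr_suml.
apply: eqmodX_sum => i; set d := (_ ^ 2)%N.
rewrite -mulrA mulrCA -[X in eqmodX _ _ X]mulr1.
have [lt_nd|le_dn] := ltnP n d; first exact: eqmodX_XnM.
apply: eqmodX_mul; first exact: eqmodX_refl.
by apply: eqmodX_gauss_bin; rewrite /d in le_dn; nia.
Qed.

(** * The identity between generating functions and its coefficients *)

Lemma prod_parity (R : comNzRingType) (F : nat -> R) m :
  \prod_(i < m.*2) F i = \prod_(k < m) (F k.*2 * F k.*2.+1).
Proof.
elim: m => [|m IHm]; first by rewrite !big_ord0.
by rewrite doubleS !big_ord_recr /= IHm mulrA.
Qed.

Lemma eqmodX_pod_gf_sqr n m : (n.*2 <= m)%N ->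
  eqmodX n (pod_gf m.*2 ^+ 2)
    ((\sum_(i < m.*2.+1) 'X^(`|i%:Z - m%:Z|%N ^ 2)) * (p3_gf m \Po 'X^2)).
Proof.
move=> le_nm; set A := pod_gf _; set B := _ \Po _; set T := \sum_(i < _) _.
pose E : {poly int} := qpoch 'X^2 m.
pose O : {poly int} := \prod_(k < m) (1 + 'X^(k.*2.+1)).
have AE : eqmodX n (A * E) O.
  (* Index [i] stands for the part [i.+1]: odd parts sit at [k.*2], where the denominator is 1, and
     even parts at [k.*2.+1], where the numerator is 1. *)
  have := @pod_gf_quotient m.*2; rewrite !prod_parity.
  rewrite (_ : \prod_(k < m) _ = E); last first.
    apply: eq_bigr => k _.
    by rewrite /pod_den /= odd_double /= mul1r -exprM mul2n doubleS.
  rewrite (_ : \prod_(k < m) _ = O); last first.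
    by apply: eq_bigr => k _; rewrite /pod_num /= odd_double /= mulr1.
  by apply: eqmodX_leq; lia.
have BE : eqmodX n (B * E ^+ 3) 1.
  have le_nm1 : (n <= m)%N by lia.
  have := eqmodX_comp_Xn (ltn0Sn 1) (eqmodX_leq le_nm1 (@p3_gf_quotient m)).
  rewrite comp_polyM comp_polyC prodrXl rmorphXn /= -/B.
  rewrite (_ : \prod_(i < m) _ \Po _ = E) // rmorph_prod; apply: eq_bigr => k _.
  by rewrite rmorphB rmorph1 /= comp_Xn_poly.
have E0 : (E ^+ 3)`_0 = 1.
  by rewrite -horner_coef0 horner_exp horner_coef0 coef0_qpoch_X2 expr1n.
apply: (eqmodX_cancel E0).
rewrite (_ : E ^+ 3 * A ^+ 2 = (A * E) * (A * E) * E); last by ring.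
rewrite (_ : E ^+ 3 * (T * B) = T * (B * E ^+ 3)); last by ring.
apply: (@eqmodX_trans _ _ _ (O * O * E)).
  by apply: eqmodX_mul; [apply: eqmodX_mul|apply: eqmodX_refl].
rewrite -expr2; apply: eqmodX_trans (eqmodX_triple_product le_nm) _.
rewrite -[X in eqmodX _ X _]mulr1.
by apply: eqmodX_mul; [apply: eqmodX_refl|apply: eqmodX_sym].
Qed.

Lemma pod_convolution n m : (n.*2 <= m)%N ->
  (\sum_(j < n.+1) pod j%:Z * pod (n - j)%N%:Z =
   \sum_(i < m.*2.+1) p3 (n%:Q / 2 - (i%:Z - m%:Z)%:Q ^+ 2 / 2))%N.
Proof.
(* The equality of natural numbers is tested in [int], where the coefficients live. *)
move=> le_nm; apply: (@mulrIn int 1 (oner_neq0 _)).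
have := eqmodX_pod_gf_sqr le_nm (leqnn n); rewrite expr2 coefM mulr_suml coef_sum.
rewrite !natr_sum => podE.
transitivity (\sum_(j < n.+1) (pod_gf m.*2)`_j * (pod_gf m.*2)`_(n - j)).
  apply: eq_bigr => j _; have := ltn_ord j => lt_jn.
  by rewrite natrM !coef_pod_gf //; lia.
rewrite podE; apply: eq_bigr => i _; set z : int := _ - _.
rewrite p3_half_sqr coefXnM coef_comp_poly_Xn //; case: ltnP => //= le_dn.
by case: ifP => // _; rewrite coef_p3_gf //; have := leq_div (n - absz z ^ 2) 2; lia.
Qed.

(** * From finite windows to sums over all indices *)

Local Open Scope classical_set_scope.

(* [\sum_(j \in A) F j] is the sum of a finitely supported family; on both
   sides only finitely many terms are nonzero. *)
Theorem theorem4p20 (n : nat) :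
  \sum_(j \in [set: nat]) pod j%:Z * pod (n%:Z - j%:Z) =
  \sum_(j \in [set: int]) p3 (n%:Q / 2 - j%:Q ^+ 2 / 2).
Proof.
(* The window [r] runs from [-m] to [m]; it contains every [j] with [j^2 <= n], as then
   [|j| <= n <= m]. *)
pose m := n.*2; pose r := [seq i%:Z - m%:Z | i <- index_iota 0 m.*2.+1].
rewrite (@fsbigE _ _ _ _ _ (index_iota 0 n.+1)) ?iota_uniq //; last first.
  move=> j _; rewrite mem_index_iota /= => jn.
  (* For [j > n] the argument is negative, and in the form [Negz] it makes [pod] reduce to its
     default 0. *)
  have -> : n%:Z - j%:Z = Negz (j - n.+1) by lia.
  by rewrite mulr0.
rewrite (@fsbigE _ _ _ _ _ r) //; last first.
- move=> j _ jr; rewrite p3_half_sqr (_ : (_ <= n)%N = false) //.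
  apply/negbTE; apply: contra jr => le_jn; apply/mapP.
  exists (absz (j + m%:Z)); first by rewrite mem_index_iota /m; nia.
  by rewrite gez0_abs ?addrK // /m; nia.
- by rewrite map_inj_uniq ?iota_uniq // => i j; lia.
under eq_bigl do rewrite in_setT.
under [RHS]eq_bigl do rewrite in_setT.
rewrite big_map !big_mkord -(pod_convolution (leqnn _)); apply: eq_bigr => j _.
by rewrite subzn // -ltnS.
Qed.
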